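(* Let $Q\in\mathbb C^{2n\times 2n}$ be a Hamiltonian matrix (i.e. $QJ=(QJ)^*$) and let $\lambda$ be a simple eigenvalue of $Q$ with corresponding right and left eigenvectors $x,y\in\mathbb C^{2n}$ (that is, $Qx=\lambda x$, $y^*Q=\lambda y^*$) normalized such that $\|x\|_2=\|y\|_2=1$. If $yx^*$ is a Hamiltonian matrix (i.e. $yx^*J=(yx^*J)^*$) or a skew-Hamiltonian matrix (i.e. $yx^*J=-(yx^*J)^*$), then $\operatorname{Re}\lambda=0$.
   Context: $J=\begin{pmatrix}0&I_n\\-I_n&0\end{pmatrix}$ is the fundamental symplectic matrix of size $2n\times 2n$; $^*$ denotes conjugate transpose and $\|\cdot\|_2$ the Euclidean norm. *)

(* Defs.v *)
From mathcomp Require Import all_boot all_order all_algebra.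
From mathcomp Require Import complex reals.

Set Implicit Arguments.
Unset Strict Implicit.
Unset Printing Implicit Defensive.

Import GRing.Theory Num.Theory.
Local Open Scope ring_scope.
Local Open Scope sesquilinear_scope.

Definition symplJ (C : numClosedFieldType) (n : nat) : 'M[C]_(n + n) :=
  block_mx 0 1%:M (- 1%:M) 0.

Definition hamiltonian (C : numClosedFieldType) (n : nat)
    (A : 'M[C]_(n + n)) : Prop :=
  A *m symplJ C n = (A *m symplJ C n)^t*.

Definition skew_hamiltonian (C : numClosedFieldType) (n : nat)
    (A : 'M[C]_(n + n)) : Prop :=
  A *m symplJ C n = - (A *m symplJ C n)^t*.

(* Valued in C, like the norm of a [numClosedFieldType]. *)
Definition norm2 (C : numClosedFieldType) (m : nat) (v : 'cV[C]_m) : C :=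
  sqrtC (\sum_(i < m) `|v i 0| ^+ 2).

(* Simplicity is algebraic: multiplicity one as a root of the
   characteristic polynomial. *)
Definition simple_eigenvalue (C : numClosedFieldType) (m : nat)
    (A : 'M[C]_m) (lambda : C) : Prop :=
  mup lambda (char_poly A) = 1%N.

(* Main.v *)
(** Applying both sides of [y x^* J = +-(y x^* J)^*] to [y] shows that [J x] is a
    multiple of [y], hence an eigenvector of [Q^*] for [conj lambda]. Since
    [Q J = - J Q^*] and [J^2 = -1], [x] is then an eigenvector of [Q] for
    [- conj lambda] as well, so [lambda = - conj lambda]. *)

Require Import Defs.
From mathcomp Require Import all_boot all_order all_algebra.
From mathcomp Require Import complex reals.

Import GRing.Theory Num.Theory.

Local Open Scope ring_scope.
Local Open Scope sesquilinear_scope.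

Lemma symplJ_sqr (C : numClosedFieldType) n :
  symplJ C n *m symplJ C n = - 1%:M.
Proof.
rewrite /symplJ mulmx_block !(mul0mx, mulmx0, mulmx1, mul1mx, add0r, addr0).
by rewrite scalar_mx_block opp_block_mx !oppr0.
Qed.

Lemma trmxC_symplJ (C : numClosedFieldType) n : (symplJ C n)^t* = - symplJ C n.
Proof.
rewrite /symplJ tr_block_mx map_block_mx !trmx0 !map_mx0 linearN /= !trmx1.
by rewrite map_mxN !map_mx1 opp_block_mx !oppr0 opprK.
Qed.

Lemma trmxC_mul (C : numClosedFieldType) m n p (A : 'M[C]_(m, n))
  (B : 'M[C]_(n, p)) : (A *m B)^t* = B^t* *m A^t*.
Proof. by rewrite trmx_mul map_mxM. Qed.

Lemma norm2_eq1 (C : numClosedFieldType) m (v : 'cV[C]_m) :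
  norm2 v = 1 -> v^t* *m v = 1%:M.
Proof.
move=> v1; rewrite [LHS]mx11_scalar mxE; congr _%:M.
(* Writing [1] as the square of [norm2 v] cancels the square root and leaves the sum of squared
   moduli. *)
rewrite -[RHS](expr1n _ 2) -v1 sqrtCK.
by apply: eq_bigr => i _; rewrite !mxE mulrC -normCK.
Qed.

Lemma hamiltonian_eigenvalue (C : numClosedFieldType) n (Q : 'M[C]_(n + n))
    (lambda : C) (x y : 'cV[C]_(n + n)) :
  hamiltonian Q -> Q *m x = lambda *: x -> y^t* *m Q = lambda *: y^t* ->
  norm2 x = 1 -> norm2 y = 1 ->
  hamiltonian (y *m x^t*) \/ skew_hamiltonian (y *m x^t*) ->
  lambda^* = - lambda.
Proof.
move=> hamQ Qx yQ /norm2_eq1 x1 /norm2_eq1 y1 hamP.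
set J := symplJ C n.
have QJ : Q *m J = - (J *m Q^t*).
  by rewrite [LHS]hamQ trmxC_mul trmxC_symplJ mulNmx.
have Qy : Q^t* *m y = lambda^* *: y.
  by rewrite -[y in LHS]trmxCK -trmxC_mul yQ linearZ /= map_mxZ trmxCK.
have [c Jx] : exists c, J *m x = c *: y.
  have PJ : (y *m x^t* *m J)^t* *m y = - (J *m x).
    by rewrite !trmxC_mul trmxCK trmxC_symplJ -!mulmxA y1 mulmx1 mulNmx.
  (* With P = y x^* J, associativity gives P y = y (x^* J y), so the scalar is c = x^* J y. As P^* y
     = - J x, the case P = P^* yields J x = - c y and the case P = - P^* yields J x = c y. *)
  pose c := (x^t* *m J *m y) 0 0.
  have Py : y *m x^t* *m J *m y = c *: y.
    by rewrite -mul_mx_scalar -mx11_scalar !mulmxA.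
  case: hamP => hamP; [exists (- c) | exists c].
    by rewrite scaleNr -Py [y *m _ *m J]hamP PJ opprK.
  by rewrite -Py [y *m _ *m J]hamP mulNmx PJ opprK.
have : lambda^* *: x = - lambda *: x.
  (* Q J (J x) is computed twice: [QJ] and [Qy] give - conj(lambda) J (J x) = conj(lambda) x, while
     J^2 = -1 gives - Q x. *)
  transitivity (Q *m J *m (J *m x)).
    rewrite QJ Jx mulNmx -mulmxA -scalemxAr Qy scalerA mulrC -scalerA.
    by rewrite -scalemxAr -Jx mulmxA symplJ_sqr mulNmx mul1mx scalerN opprK.
  rewrite -mulmxA [J *m (J *m x)]mulmxA symplJ_sqr mulNmx mul1mx mulmxN Qx.
  by rewrite scaleNr.
(* Since x^* x = 1, multiplying by x^* on the left leaves the scalars. *)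
move/(congr1 (mulmx (x^t*))); rewrite -!scalemxAr x1 => /matrixP/(_ 0 0).
by rewrite !mxE !mulr1.
Qed.

Theorem proposition2p5 (R : realType) (n : nat) (Q : 'M[R[i]]_(n + n))
    (lambda : R[i]) (x y : 'cV[R[i]]_(n + n)) :
  hamiltonian Q ->
  simple_eigenvalue Q lambda ->
  Q *m x = lambda *: x ->
  y^t* *m Q = lambda *: y^t* ->
  norm2 x = 1 ->
  norm2 y = 1 ->
  hamiltonian (y *m x^t*) \/ skew_hamiltonian (y *m x^t*) ->
  complex.Re lambda = 0.
Proof.
move=> hamQ _ Qx yQ x1 y1 hamP.
have /(congr1 (@complex.Re R)) :=
  hamiltonian_eigenvalue _ _ _ _ _ _ hamQ Qx yQ x1 y1 hamP.
(* For lambda = a + ib the real parts read a = - a, so 2a = 0. *)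
case: lambda {Qx yQ} => a b /= /eqP.
by rewrite -addr_eq0 -mulr2n mulrn_eq0 => /eqP.
Qed.
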